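(* Let $G:\mathbb{R}_+\to\mathbb{R}_+$ be a function such that $G(0)>0$. The kernel $G$ preserves nonnegativity if and only if, for every $l\in\mathbb{N}^*$, the function $G_l:(\mathbb{R}_+^* )^l\to\mathbb{R}$ is nonnegative.
   Context: Notation: $\mathbb{R}_+=[0,\infty)$, $\mathbb{R}_+^*=(0,\infty)$, $\mathbb{N}^*=\{1,2,\dots\}$. Nonnegativity preserving kernel: a function (kernel) $G:\mathbb{R}_+\to\mathbb{R}_+$ with $G(0)>0$ is said to preserve nonnegativity if, for any $K\in\mathbb{N}^*$, any $x_1,\dots,x_K\in\mathbb{R}$ and any $0\le t_1<\dots<t_K$ such that $\sum_{k'=1}^k x_{k'}G(t_k-t_{k'})\ge 0$ for all $k\in\{1,\dots,K\}$, one has $\sum_{k:\,t_k\le t}x_kG(t-t_k)\ge 0$ for all $t\ge 0$ (an empty sum is $0$). Functions $G_l$: for $G:\mathbb{R}_+\to\mathbb{R}_+$ with $G(0)>0$, the functions $G_l:(\mathbb{R}_+^* )^l\to\mathbb{R}$, $l\in\mathbb{N}^*$, are defined by induction by $G_1(a_1)=G(a_1)/G(0)$ for $a_1>0$ and, for $l\ge 2$ and $a_1,\dots,a_l>0$, $$G_l(a_1,\dots,a_l)=G_{l-1}(a_1,\dots,a_{l-2},a_{l-1}+a_l)-G_1(a_l)\,G_{l-1}(a_1,\dots,a_{l-1}).$$ *)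

(* Defs.v *)
From HB Require Import structures.
From mathcomp Require Import all_boot all_order all_algebra.
From mathcomp Require Import reals.

Set Implicit Arguments.
Unset Strict Implicit.
Unset Printing Implicit Defensive.

Import Order.TTheory GRing.Theory Num.Theory.
Local Open Scope ring_scope.

Section Kernels.
Variable R : realType.

(* A kernel on [0, +oo) is represented by a function on the whole of R; every
   argument to which it is applied below is nonnegative under the stated
   conditions, so its values at negative arguments are irrelevant. *)
Variable G : R -> R.

Definition preserves_nonnegativity : Prop :=
  forall (K : nat) (x t : 'I_K -> R),
    (0 < K)%N ->
    (forall k : 'I_K, 0 <= t k) ->
    (forall i j : 'I_K, (i < j)%N -> t i < t j) ->
    (forall k : 'I_K, 0 <= \sum_(k' < K | (k' <= k)%N) x k' * G (t k - t k')) ->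
    forall s : R, 0 <= s -> 0 <= \sum_(k < K | t k <= s) x k * G (s - t k).

(* (a_1, ..., a_l, a_{l+1}) |-> (a_1, ..., a_l) *)
Definition drop_last (l : nat) (a : 'I_l.+1 -> R) : 'I_l -> R :=
  fun i => a (widen_ord (leqnSn l) i).

(* (a_1, ..., a_l, a_{l+1}) |-> (a_1, ..., a_{l-1}, a_l + a_{l+1}) *)
Definition merge_last (l : nat) (a : 'I_l.+1 -> R) : 'I_l -> R :=
  fun i => if i.+1 == l then drop_last a i + a ord_max else drop_last a i.

(* G_l is only meant for l >= 1; the value at l = 0 is a dummy. *)
Fixpoint Gl (l : nat) : ('I_l -> R) -> R :=
  match l return ('I_l -> R) -> R with
  | 0%N => fun=> 0
  | m.+1 =>
      match m return (('I_m -> R) -> R) -> ('I_m.+1 -> R) -> R with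
      | 0%N => fun _ a => G (a ord0) / G 0
      | _.+1 => fun Gm a =>
          Gm (merge_last a) - G (a ord_max) / G 0 * Gm (drop_last a)
      end (@Gl m)
  end.

End Kernels.

(* Main.v *)
(* Let F_n(s) = sum_{k<n} x_k G(s - t_k) and y_n = F_{n+1}(t_n).  Eliminating
   x_n from F_{n+1}(s) = F_n(s) + x_n G(s - t_n) gives
     F_{n+1}(s) = F_n(s) + (y_n - F_n(t_n)) G(s - t_n) / G(0),
   and unrolling this recursion yields
     F_n(s) = sum_{k<n} y_k G_{n-k}(t_{k+1} - t_k, ..., s - t_{n-1}).
   If all G_l are nonnegative, so is F_n(s).  Conversely, choosing x such that
   y = (1, 0, 0, ...) makes F_l(s) equal to an arbitrary value of G_l. *)
Require Import Defs.
From mathcomp Require Import all_boot all_order all_algebra.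
From mathcomp Require Import reals.
From mathcomp Require Import ring.

Set Implicit Arguments.
Unset Strict Implicit.
Unset Printing Implicit Defensive.

Import Order.TTheory GRing.Theory Num.Theory.
Local Open Scope ring_scope.

Section KernelExpansion.
Variables (R : realType) (G : R -> R).
Implicit Types (x t : nat -> R) (s : R).

Lemma eq_Gl (l : nat) (a b : 'I_l -> R) : a =1 b -> Gl G a = Gl G b.
Proof.
elim: l a b => [|[|l] IHl] a b eq_ab //=; first by rewrite eq_ab.
rewrite eq_ab; congr (_ - _ * _); apply: IHl => i.
  by rewrite /merge_last /drop_last !eq_ab.
by rewrite /drop_last eq_ab.
Qed.

(* G_n(t_1 - t_0, ..., t_{n-1} - t_{n-2}, s - t_{n-1}) *)
Definition Gl_pts t (n : nat) s : R :=
  Gl G (fun i : 'I_n => (if i.+1 == n then s else t i.+1) - t i).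

(* At n = 0 the dummy value of [Gl] makes this the formula for G_1. *)
Lemma Gl_ptsS t n s :
  Gl_pts t n.+1 s =
    Gl_pts t n s + ((n == 0%N)%:R - Gl_pts t n (t n)) * (G (s - t n) / G 0).
Proof.
rewrite /Gl_pts; case: n => [|n] /=; first by rewrite add0r subr0 mul1r.
rewrite eqxx sub0r mulNr mulrC; congr (_ - _ * _); apply: eq_Gl => i.
  (* Merging the last two gaps telescopes and removes the point [t n.+1]; dropping the last gap ends
     the chain at [t n.+1]. *)
  rewrite /merge_last /drop_last /= eqxx !eqSS.
  rewrite (ltn_eqF (ltn_ord i)).
  by case: eqP => [->|_] //; rewrite addrC addrA subrK.
rewrite /drop_last /= !eqSS (ltn_eqF (ltn_ord i)).
by case: eqP => [->|].
Qed.

Lemma Gl_pts_ge0 t n s :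
  (forall l : nat, (0 < l)%N ->
     forall a : 'I_l -> R, (forall i, 0 < a i) -> 0 <= Gl G a) ->
  (forall i, (i.+1 < n)%N -> t i < t i.+1) -> t n.-1 < s ->
  0 <= Gl_pts t n s.
Proof.
case: n => [|n] // Gl_ge0 t_incr ts; apply: Gl_ge0 => // i.
rewrite subr_gt0 eqSS; case: eqP => [->|/eqP ne_in] //.
by apply: t_incr; rewrite ltnS ltn_neqAle ne_in -ltnS ltn_ord.
Qed.

(** No cutoff [t k <= s]: the identities below are algebraic, and the order of the points matters
    only for signs. *)
Definition response x t (n : nat) s : R := \sum_(k < n) x k * G (s - t k).

Lemma responseS x t n s :
  response x t n.+1 s = response x t n s + x n * G (s - t n).
Proof. exact: big_ord_recr. Qed.

Hypothesis G0_gt0 : 0 < G 0.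

Lemma response_expansion x t n s :
  response x t n s =
    \sum_(k < n) response x t k.+1 (t k) *
      Gl_pts (fun i => t (k + i)%N) (n - k) s.
Proof.
have G0_neq0 : G 0 != 0 by rewrite gt_eqF.
elim: n s => [|n IHn] s; first by rewrite /response !big_ord0.
rewrite big_ord_recr /= subSnn Gl_ptsS addn0.
(* For [k < n] the indicator vanishes, and the correction terms refold into F_n(t_n), which differs
   from y_n by x_n G(0). *)
under eq_bigr => k _ do
  rewrite subSn 1?ltnW // Gl_ptsS (subnKC (ltnW (ltn_ord k)))
    gtn_eqF ?subn_gt0 // sub0r mulNr mulrBr mulrA.
rewrite sumrB -mulr_suml -!IHn !responseS subrr /Gl_pts /=.
by field.
Qed.

(* The weights for which y = (1, 0, 0, ...). *)
Definition impulse_weights t (n : nat) : R :=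
  ((n == 0%N)%:R - Gl_pts t n (t n)) / G 0.

Lemma response_impulse t n s : response (impulse_weights t) t n s = Gl_pts t n s.
Proof.
elim: n s => [|n IHn] s; first by rewrite /response big_ord0.
by rewrite responseS IHn Gl_ptsS /impulse_weights -mulrA [_^-1 * _]mulrC.
Qed.

Lemma response_impulse_diag t n :
  response (impulse_weights t) t n.+1 (t n) = (n == 0%N)%:R.
Proof.
by rewrite response_impulse Gl_ptsS subrr divff ?mulr1 1?addrC ?subrK // gt_eqF.
Qed.

(** Induction on [n] discards the points later than [s]; once none is left, the expansion has only
    nonnegative terms. *)
Lemma Gl_ge0_response_ge0 x t n s :
  (forall l : nat, (0 < l)%N ->
     forall a : 'I_l -> R, (forall i, 0 < a i) -> 0 <= Gl G a) ->
  (forall i j, (i < j)%N -> (j < n)%N -> t i < t j) ->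
  (forall k, (k < n)%N -> 0 <= response x t k.+1 (t k)) ->
  0 <= \sum_(k < n | t k <= s) x k * G (s - t k).
Proof.
move=> Gl_ge0; elim: n => [|n IHn] t_incr y_ge0; first by rewrite big_ord0.
have [tn_s|s_tn] := leP (t n) s; last first.
  rewrite big_mkcond big_ord_recr /= (leNgt (t n)) s_tn addr0 -big_mkcond.
  by apply: IHn => [i j lt_ij /ltnW|k /ltnW]; [apply: t_incr|apply: y_ge0].
rewrite (eq_bigl predT) => [|k]; last first.
  have := ltn_ord k; rewrite ltnS leq_eqVlt => /predU1P[->|lt_kn] //.
  by apply/ltW/(lt_le_trans _ tn_s)/t_incr.
rewrite -/(response x t n.+1 s).
(* At [s = t n] the last gap is 0, outside the domain of G_l, but the value is then y_n itself. *)
move: tn_s; rewrite le_eqVlt => /predU1P[<-|tn_s]; first exact: y_ge0.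
rewrite response_expansion; apply: sumr_ge0 => k _.
apply: mulr_ge0; first exact: y_ge0.
have le_kn : (k <= n)%N by rewrite -ltnS.
apply: Gl_pts_ge0 => // [i|].
  by rewrite ltn_subRL => lt_n; apply: t_incr; rewrite ?ltn_add2l.
by rewrite subSn //= subnKC.
Qed.

End KernelExpansion.

Theorem theorem2p6 (R : realType) (G : R -> R)
    (G_ge0 : forall t : R, 0 <= t -> 0 <= G t) (G0_gt0 : 0 < G 0) :
  preserves_nonnegativity G <->
  (forall l : nat, (0 < l)%N ->
     forall a : 'I_l -> R, (forall i : 'I_l, 0 < a i) -> 0 <= Gl G a).
Proof.
split=> [presG [//|l] _ a a_gt0 | Gl_ge0 [//|K] x t _ t_ge0 t_incr y_ge0 s _].
  (* Points whose successive gaps are the entries of [a]. Past index [l], [inord] falls back to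
     [ord0], so [t] keeps increasing. *)
  pose t n : R := \sum_(i < n) a (inord i).
  have tS n : t n.+1 = t n + a (inord n) by exact: big_ord_recr.
  have t_ge0 n : 0 <= t n by apply: sumr_ge0 => i _; apply/ltW.
  have t_incr : {homo t : i j / (i < j)%N >-> i < j}.
    by apply: homo_ltn => [? ? ?|n]; [exact: lt_trans | rewrite tS ltrDl].
  have -> : Gl G a = Gl_pts G t l.+1 (t l.+1).
    apply: eq_Gl => i; rewrite (_ : (if _ then _ else _) = t i.+1).
      by rewrite tS addrC addKr inord_val.
    by case: eqP => [->|].
  rewrite -response_impulse //.
  have := presG l.+1 (fun i => impulse_weights G t i) (fun i => t i) isT.
  move=> /(_ (fun=> t_ge0 _) (fun _ _ => t_incr _ _)) /(_ _ (t l.+1) (t_ge0 _)).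
  rewrite (eq_bigl predT) => [|k]; last exact/ltW/t_incr.
  apply=> k; rewrite -(big_ord_widen _
    (fun j => impulse_weights G t j * G (t k - t j)) (ltn_ord k)).
  by rewrite -/(response G _ _ _ _) response_impulse_diag.
(* Extends the finite families to sequences; only indices at most [K] matter. *)
pose x' n := x (inord n); pose t' n := t (inord n).
rewrite (eq_big (fun k : 'I_K.+1 => t' k <= s)
                (fun k : 'I_K.+1 => x' k * G (s - t' k))) => [|k|k _];
  rewrite /x' /t' ?inord_val //.
apply: (Gl_ge0_response_ge0 G0_gt0 (x := x') (t := t')) => // [i j lt_ij lt_jK|k lt_kK].
  by apply: t_incr; rewrite !inordK // (ltn_trans lt_ij).
have := y_ge0 (inord k); rewrite inordK //.
rewrite (eq_bigr (fun j : 'I_K.+1 => x' j * G (t' k - t' j))) => [|j _].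
  by rewrite -(big_ord_widen _ (fun j => x' j * G (t' k - t' j)) lt_kK).
by rewrite /x' /t' inord_val.
Qed.
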